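(* Let $X$ be a (real) Banach space with a Schauder basis $(e_n)_{n\in\mathbb{N}}$, with biorthogonal functionals $(e_n^* )_{n\in\mathbb{N}}$. The following are equivalent. (1) The map $e_n^*\mapsto e_n^*\otimes e_n$ ($n\in\mathbb{N}$) can be extended to an isomorphism (linear homeomorphism) between $X^*$ and $\mathcal{L}_{\mathrm{diag}}(X)$. (2) Both of the following hold: (a) the basis $(e_n)_{n\in\mathbb{N}}$ dominates the summing basis; (b) the norm in $X^*$ is submultiplicative, i.e. there exists $C>0$ such that for every $n\in\mathbb{N}$ and all scalars $a_1,\beta_1,\ldots,a_n,\beta_n$, $$\Big\|\sum_{i=1}^n a_i\beta_i e_i^*\Big\|\le C\cdot\Big\|\sum_{i=1}^n a_ie_i^*\Big\|\cdot\Big\|\sum_{i=1}^n\beta_ie_i^*\Big\|.$$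
   Context: $\mathcal{L}_{\mathrm{diag}}(X)$ denotes the space, with the operator norm, of all bounded linear operators $T:X\to X$ which are diagonal with respect to the basis $(e_n)$, i.e. for which there is a scalar sequence $(\lambda_n)_{n}$ with $Te_n=\lambda_ne_n$ for all $n$. The operator $e_n^*\otimes e_n$ is the rank one diagonal operator $x\mapsto e_n^*(x)e_n$. The basis $(e_n)$ dominates the summing basis if there is a constant $C_1>0$ such that $C_1\,|\sum_{i=1}^n\mu_i|\le\|\sum_{i=1}^n\mu_ie_i\|$ for every finite sequence of scalars $(\mu_i)_{i=1}^n$. *)

(* Defs.v *)
From HB Require Import structures.
From mathcomp Require Import all_boot all_order all_algebra.
From mathcomp Require Import all_classical all_reals all_analysis.

Set Implicit Arguments.
Unset Strict Implicit.
Unset Printing Implicit Defensive.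

Import Order.TTheory GRing.Theory Num.Theory.
Import numFieldNormedType.Exports.

Local Open Scope classical_set_scope.
Local Open Scope ring_scope.

Section BoundedLinearOperators.
Context {R : realType} {X Y : normedModType R}.

Definition bounded_linear_pred : {pred X -> Y} :=
  [pred f : X -> Y | `[< linear f /\ continuous f >]].

(* For linear maps, continuity is the same as boundedness:
   linear_bounded_continuous. *)
Record bounded_linear := BoundedLinear {
  bounded_linear_fun :> X -> Y;
  bounded_linear_spec : bounded_linear_fun \in bounded_linear_pred }.

HB.instance Definition _ := [isSub for bounded_linear_fun].
HB.instance Definition _ := [Choice of bounded_linear by <:].

Lemma bounded_linearP (f : X -> Y) :
  reflect (linear f /\ continuous f) (f \in bounded_linear_pred).
Proof. exact: asboolP. Qed.

Fact bounded_linear_submod_closed : submod_closed bounded_linear_pred.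
Proof.
split=> [|a f g /bounded_linearP[lf cf] /bounded_linearP[lg cg]].
  apply/bounded_linearP; split => [a x y|x]; last exact: cst_continuous.
  by rewrite -[LHS]/(0 : Y) -[RHS]/(a *: 0 + 0 : Y) scaler0 addr0.
apply/bounded_linearP; split => [b x y|x].
  rewrite -[LHS]/(a *: f (b *: x + y) + g (b *: x + y)).
  rewrite -[RHS]/(b *: (a *: f x + g x) + (a *: f y + g y)).
  by rewrite lf lg !scalerDr !scalerA (mulrC a b) addrACA.
apply: (@cvgD _ _ _ _ _ (a \*: f) g) => //; last exact: cg.
by apply: cvgZl_tmp; exact: cf.
Qed.

HB.instance Definition _ := GRing.isSubmodClosed.Build R (X -> Y)
  bounded_linear_pred bounded_linear_submod_closed.
HB.instance Definition _ := [SubChoice_isSubLmodule of bounded_linear by <:].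

Section linear_instance.
Variable T : bounded_linear.

Fact bounded_linear_lin : linear T.
Proof. by case/bounded_linearP: (bounded_linear_spec T). Qed.

Fact bounded_linear_cont : continuous T.
Proof. by case/bounded_linearP: (bounded_linear_spec T). Qed.

HB.instance Definition _ :=
  GRing.isLinear.Build R X Y *:%R T bounded_linear_lin.

End linear_instance.

Definition opnorm (T : bounded_linear) : R :=
  sup [set `|T x| | x in [set x : X | `|x| <= 1]].

Fact opnorm_has_sup (T : bounded_linear) :
  has_sup [set `|T x| | x in [set x : X | `|x| <= 1]].
Proof.
split; first by exists `|T 0|, 0 => //=; rewrite normr0.
have /linear_bounded_continuous/bounded_funP/(_ 1)[M TM] :=
  @bounded_linear_cont T.
by exists M => _ [x /= x1 <-]; exact: TM.
Qed.

Fact opnorm_ub (T : bounded_linear) (x : X) : `|x| <= 1 -> `|T x| <= opnorm T.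
Proof.
move=> x1; apply: sup_upper_bound; first exact: opnorm_has_sup.
by exists x.
Qed.

Fact opnorm_le (T : bounded_linear) (M : R) :
  (forall x, `|x| <= 1 -> `|T x| <= M) -> opnorm T <= M.
Proof.
move=> TM; apply: ge_sup; first by case: (opnorm_has_sup T).
by move=> _ [x /= x1 <-]; exact: TM.
Qed.

Fact opnormD (S T : bounded_linear) : opnorm (S + T) <= opnorm S + opnorm T.
Proof.
apply: opnorm_le => x x1; rewrite (le_trans (ler_normD _ _))//.
by rewrite lerD// opnorm_ub.
Qed.

Fact opnormZ_le (a : R) (T : bounded_linear) :
  opnorm (a *: T) <= `|a| * opnorm T.
Proof.
by apply: opnorm_le => x x1; rewrite normrZ ler_wpM2l// opnorm_ub.
Qed.

Fact opnorm0 : opnorm 0 = 0.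
Proof.
apply/eqP; rewrite eq_le; apply/andP; split.
  by apply: opnorm_le => x _; rewrite normr0.
by apply: le_trans (@opnorm_ub 0 0 _); rewrite ?normr0.
Qed.

Fact opnormZ (a : R) (T : bounded_linear) : opnorm (a *: T) = `|a| * opnorm T.
Proof.
have [->|a0] := eqVneq a 0; first by rewrite scale0r normr0 mul0r opnorm0.
apply/eqP; rewrite eq_le opnormZ_le /=.
rewrite -ler_pdivlMl ?normr_gt0// -normfV.
by rewrite -[X in opnorm X <= _](scalerK a0) opnormZ_le.
Qed.

Fact opnorm_eq0 (T : bounded_linear) : opnorm T = 0 -> T = 0.
Proof.
move=> T0; apply/val_inj/funext => x /=.
have [->|x0] := eqVneq x 0; first exact: linear0.
have : `|T (`|x|^-1 *: x)| <= 0 by rewrite -T0 opnorm_ub// normfZV.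
rewrite normr_le0 linearZ/= scaler_eq0 invr_eq0 normr_eq0 (negPf x0)/=.
by move/eqP.
Qed.

HB.instance Definition _ := Lmodule_isNormed.Build R bounded_linear
  opnormD opnormZ opnorm_eq0.

End BoundedLinearOperators.
Arguments bounded_linear {R} X Y.

Notation "''L' ( X , Y )" := (bounded_linear X Y)
  (at level 8, format "''L' ( X ,  Y )") : type_scope.

Definition dual_space {R : realType} (X : normedModType R) := 'L(X, R^o).

Section RankOne.
Context {R : realType} {X Y : normedModType R} (f : 'L(X, R^o)) (y : Y).

Fact rank_one_spec : (fun x => f x *: y) \in @bounded_linear_pred R X Y.
Proof.
apply/bounded_linearP; split => [a u v|x]; first by rewrite linearP scalerDl scalerA.
by apply: cvgZr_tmp; exact: bounded_linear_cont.
Qed.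

Definition rank_one : 'L(X, Y) := BoundedLinear rank_one_spec.

End RankOne.

Notation "f '\otimes' y" := (rank_one f y) (at level 40) : ring_scope.

Section DiagonalOperators.
Context {R : realType} {X : normedModType R} (e : nat -> X).

Definition diagonal_pred : {pred 'L(X, X)} :=
  [pred T : 'L(X, X) |
    `[< exists lambda : nat -> R, forall n, T (e n) = lambda n *: e n >]].

Record Ldiag := LDiag {
  Ldiag_op :> 'L(X, X);
  Ldiag_spec : Ldiag_op \in diagonal_pred }.

HB.instance Definition _ := [isSub for Ldiag_op].
HB.instance Definition _ := [Choice of Ldiag by <:].

Fact diagonal_submod_closed : submod_closed diagonal_pred.
Proof.
split; first by apply/asboolP; exists (fun=> 0) => n; rewrite scale0r.
move=> a S T /asboolP[s Ss] /asboolP[t Tt]; apply/asboolP.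
exists (fun n => a * s n + t n) => n.
by rewrite scalerDl -scalerA -Ss -Tt.
Qed.

HB.instance Definition _ := GRing.isSubmodClosed.Build R 'L(X, X)
  diagonal_pred diagonal_submod_closed.
HB.instance Definition _ := [SubChoice_isSubLmodule of Ldiag by <:].

Definition Ldiag_norm (T : Ldiag) : R := `|Ldiag_op T|.

Fact Ldiag_normD (S T : Ldiag) :
  Ldiag_norm (S + T) <= Ldiag_norm S + Ldiag_norm T.
Proof. exact: ler_normD. Qed.

Fact Ldiag_normZ (a : R) (T : Ldiag) :
  Ldiag_norm (a *: T) = `|a| * Ldiag_norm T.
Proof. exact: normrZ. Qed.

Fact Ldiag_norm_eq0 (T : Ldiag) : Ldiag_norm T = 0 -> T = 0.
Proof. by move/normr0_eq0 => T0; exact: val_inj. Qed.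

HB.instance Definition _ := Lmodule_isNormed.Build R Ldiag
  Ldiag_normD Ldiag_normZ Ldiag_norm_eq0.

End DiagonalOperators.

Section Bases.
Context {R : realType} {X : normedModType R}.

Definition schauder_basis (e : nat -> X) : Prop :=
  forall x : X, exists! a : nat -> R,
    series (fun n => a n *: e n) @ \oo --> x.

Definition biorthogonal (e : nat -> X) (es : nat -> dual_space X) : Prop :=
  forall m n, es m (e n) = (m == n)%:R.

Definition dominates_summing_basis (e : nat -> X) : Prop :=
  exists2 C : R, 0 < C &
    forall (n : nat) (mu : 'I_n -> R),
      C * `|\sum_(i < n) mu i| <= `|\sum_(i < n) mu i *: e i|.

Definition dual_norm_submultiplicative (es : nat -> dual_space X) : Prop :=
  exists2 C : R, 0 < C &
    forall (n : nat) (a b : 'I_n -> R),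
      `|\sum_(i < n) (a i * b i) *: es i| <=
        C * `|\sum_(i < n) a i *: es i| * `|\sum_(i < n) b i *: es i|.

End Bases.

Definition linear_homeomorphism {R : realType} {V W : normedModType R}
    (f : V -> W) : Prop :=
  [/\ linear f, continuous f &
    exists g : W -> V, [/\ cancel f g, cancel g f & continuous g]].

(* Main.v *)
(* If Phi is an isomorphism, then on finite sums the norm of sum a_i e_i^* is
   equivalent to the operator norm of sum a_i e_i^* (x) e_i. The latter is
   submultiplicative because such operators compose coordinatewise, and with
   a_i = 1 it is bounded by the basis constant, which makes the functionals
   sum_(i < n) e_i^* uniformly bounded: this is domination of the summing basis.

   Conversely, domination yields a functional s with s(e_n) = 1 for all n, and
   submultiplicativity with a norming functional (Hahn-Banach) bounds the
   diagonal operator T_f with entries f(e_n) by a multiple of the norm of f.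
   Then f |-> T_f and T |-> s o T are mutually inverse. *)
Require Import Defs.
From HB Require Import structures.
From mathcomp Require Import all_boot all_order all_algebra.
From mathcomp Require Import all_classical all_reals all_analysis.
Import Order.TTheory GRing.Theory Num.Theory.
Import numFieldNormedType.Exports.
Local Open Scope classical_set_scope.
Local Open Scope ring_scope.

Set Implicit Arguments.
Unset Strict Implicit.
Unset Printing Implicit Defensive.

(** * The Hahn-Banach theorem through minimal sublinear functionals *)

Section SublinearFunctionals.
Context {R : realType} {V : lmodType R}.
Implicit Types (p q : V -> R) (v w x y : V).

Definition sublinear p : Prop :=
  (forall x y, p (x + y) <= p x + p y) /\
  (forall c x, 0 <= c -> p (c *: x) = c * p x).

(** The reverse homogeneity inequality is the assumed one at [c^-1] and [c *: x]; [0 <= p 0] follows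
    from subadditivity. *)
Lemma sublinear_le p :
  (forall x y, p (x + y) <= p x + p y) -> p 0 <= 0 ->
  (forall c x, 0 < c -> p (c *: x) <= c * p x) -> sublinear p.
Proof.
move=> pD p0 pZ; split=> // c x; rewrite le_eqVlt => /predU1P[<-|c0].
  rewrite scale0r mul0r; apply/eqP; rewrite eq_le p0/=.
  by have := pD 0 0; rewrite addr0 lerDl.
apply/eqP; rewrite eq_le pZ//=.
rewrite -ler_pdivlMl//; have := pZ c^-1 (c *: x).
by rewrite invr_gt0 scalerA mulVf ?gt_eqF// scale1r; exact.
Qed.

Lemma sublinear0 p : sublinear p -> p 0 = 0.
Proof. by case=> _ /(_ 0 0 (lexx _)); rewrite scale0r mul0r. Qed.

Lemma sublinear_opp p x : sublinear p -> - p (- x) <= p x.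
Proof.
move=> sp; rewrite -subr_ge0 opprK -(sublinear0 sp) -[X in p X](subrr x).
exact: sp.1.
Qed.

(* A sublinear functional below [p] which is moreover odd on the line through [w];
   hence a minimal sublinear functional is linear. *)
Definition descend p w x : R :=
  inf [set p (x + t *: w) - t * p w | t in [set t | 0 <= t]].

Section descend.
Variables (p : V -> R) (w : V).
Hypothesis sp : sublinear p.

Let descend_set x := [set p (x + t *: w) - t * p w | t in [set t | 0 <= t]].

(** Subadditivity for [t *: w = (x + t *: w) + (- x)]. It makes the infimum in [descend] a genuine
    one. *)
Let descend_lb x : lbound (descend_set x) (- p (- x)).
Proof.
move=> _ [t /= t0 <-]; rewrite lerBrDr -sp.2// addrC lerBlDr.
by apply: le_trans (sp.1 _ _); rewrite addrAC subrr add0r.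
Qed.

Lemma descend_has_inf x : has_inf (descend_set x).
Proof.
by split; [exists (p (x + 0 *: w) - 0 * p w), 0 => /=|exists (- p (- x))].
Qed.

Lemma descend_lbound t x : 0 <= t -> descend p w x <= p (x + t *: w) - t * p w.
Proof. by move=> t0; apply: ge_inf; [exact: (descend_has_inf x).2|exists t]. Qed.

Lemma descend_le x : descend p w x <= p x.
Proof. by have := descend_lbound x (lexx 0); rewrite scale0r mul0r addr0 subr0. Qed.

Lemma descend_opp : descend p w (- w) <= - p w.
Proof.
have := descend_lbound (- w) ler01.
by rewrite scale1r mul1r addNr sublinear0// sub0r.
Qed.

Lemma le_descend x m :
  (forall t, 0 <= t -> m <= p (x + t *: w) - t * p w) -> m <= descend p w x.
Proof.
move=> h; apply: lb_le_inf; first exact: (descend_has_inf x).1.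
by move=> _ [t t0 <-]; exact: h.
Qed.

(** Parameters [s] for [x] and [t] for [y] combine to [s + t] for [x + y]; scaling by [c] replaces
    [t] by [c * t]. *)
Lemma sublinear_descend : sublinear (descend p w).
Proof.
apply: sublinear_le.
- move=> x y; rewrite -lerBlDr; apply: le_descend => s s0.
  rewrite lerBlDr -lerBlDl; apply: le_descend => t t0; rewrite lerBlDl.
  apply: le_trans (descend_lbound (x + y) (addr_ge0 s0 t0)) _.
  by rewrite [leRHS]addrACA -opprD -mulrDl lerD2r scalerDl (addrACA x) sp.1.
- by apply: le_trans (descend_le 0) _; rewrite sublinear0.
- move=> c x c0; rewrite -ler_pdivrMl//; apply: le_descend => t t0.
  rewrite ler_pdivrMl// mulrBr -(sp.2 c) ?(ltW c0)// scalerDr scalerA mulrA.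
  by apply: descend_lbound; rewrite mulr_ge0// ltW.
Qed.

End descend.

(* A lower bound of a chain is its pointwise infimum. *)
Lemma exists_minimal_sublinear p : sublinear p -> exists q,
  [/\ sublinear q, forall x, q x <= p x &
    forall r, sublinear r -> (forall x, r x <= q x) -> forall x, r x = q x].
Proof.
move=> sp; pose T := {q : V -> R | sublinear q /\ forall x, q x <= p x}.
(* The pointwise order is reversed, so that a maximal element in Zorn's lemma is a minimal
   functional. *)
pose Rel (q r : T) := `[< forall x, sval r x <= sval q x >].
have [||||[q [sq qp]] qmin] := @Zorn T Rel.
- by move=> q; apply/asboolP.
- move=> q r s /asboolP qr /asboolP rs; apply/asboolP => x.
  exact: le_trans (rs x) (qr x).
- move=> [q Pq] [r Pr] /asboolP qr /asboolP rq; apply: eq_exist.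
  by apply/funext => x; apply/eqP; rewrite eq_le; apply/andP; split;
    [exact: rq|exact: qr].
- move=> A totA; have [[q0 Aq0]|A0] := pselect (exists q : T, A q); last first.
    by exists (exist _ p (conj sp (fun=> lexx _))) => q Aq; case: A0; exists q.
  pose m x := inf [set sval q x | q in A].
  have m_has_inf x : has_inf [set sval q x | q in A].
    split; first by exists (sval q0 x), q0.
    exists (- p (- x)) => _ [[q [sq qp]] _ <-] /=.
    by apply: le_trans (sublinear_opp x sq); rewrite lerN2.
  have m_le (q : T) x : A q -> m x <= sval q x.
    by move=> Aq; apply: ge_inf; [exact: (m_has_inf x).2|exists q].
  have le_m x c : (forall q : T, A q -> c <= sval q x) -> c <= m x.
    move=> h; apply: lb_le_inf; first exact: (m_has_inf x).1.
    by move=> _ [q Aq <-]; exact: h.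
  have sm : sublinear m.
    apply: sublinear_le.
    + move=> x y; rewrite -lerBlDr; apply: (le_m) => q Aq.
      rewrite lerBlDr -lerBlDl; apply: (le_m) => r Ar; rewrite lerBlDl.
      (* In a chain, the smaller of [q] and [r] can be used at both [x] and [y]. *)
      have [/asboolP rq|/asboolP qr] := totA _ _ Aq Ar.
        by apply: le_trans (m_le _ _ Ar) _;
          apply: le_trans ((svalP r).1.1 _ _) _; rewrite lerD2r.
      by apply: le_trans (m_le _ _ Aq) _;
        apply: le_trans ((svalP q).1.1 _ _) _; rewrite lerD2l.
    + apply: le_trans (m_le _ _ Aq0) _.
      by rewrite (sublinear0 (svalP q0).1).
    + move=> c x c0; rewrite -ler_pdivrMl//; apply: (le_m) => q Aq.
      by rewrite ler_pdivrMl// -((svalP q).1.2 c) ?(ltW c0)// m_le.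
  have mp x : m x <= p x by apply: le_trans (m_le _ _ Aq0) ((svalP q0).2 x).
  by exists (exist _ m (conj sm mp)) => q Aq; apply/asboolP => x; exact: m_le.
exists q; split=> // r sr rq.
have rp x : r x <= p x by exact: le_trans (rq x) (qp x).
have /qmin[-> //] : Rel (exist _ q (conj sq qp)) (exist _ r (conj sr rp)).
exact/asboolP.
Qed.

(** Minimality forces [descend q x] to equal [q], whence [q (- x) <= - q x]. Oddness then handles
    negative scalars and turns subadditivity into superadditivity. *)
Lemma minimal_sublinear_linear q : sublinear q ->
  (forall r, sublinear r -> (forall x, r x <= q x) -> forall x, r x = q x) ->
  linear (q : V -> R^o).
Proof.
move=> sq qmin.
have qN x : q (- x) = - q x.
  have dq := qmin _ (sublinear_descend x sq) (descend_le x sq).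
  apply/eqP; rewrite eq_le -{1}dq descend_opp//=.
  by rewrite lerNl; exact: sublinear_opp.
have qZ c x : q (c *: x) = c * q x.
  have [c0|/ltW c0] := leP 0 c; first exact: sq.2.
  by rewrite -[c]opprK scaleNr qN (sq.2 (- c)) ?oppr_ge0// !mulNr.
move=> c x y; rewrite -[RHS]/(c * q x + q y) -qZ.
apply/eqP; rewrite eq_le sq.1/= -lerN2 opprD -!qN opprD; exact: sq.1.
Qed.

(** The minimal functional is taken below [descend p v] rather than [p]: its value at [- v] is then
    at most [- p v], which pins its value at [v]. *)
Lemma Hahn_Banach p v : sublinear p ->
  exists f : V -> R^o, [/\ linear f, forall x, f x <= p x & f v = p v].
Proof.
move=> sp; have sd := sublinear_descend v sp.
have [q [sq qd qmin]] := exists_minimal_sublinear sd.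
have lq := minimal_sublinear_linear sq qmin.
have qp x : q x <= p x by exact: le_trans (qd x) (descend_le v sp x).
exists q; split=> //; apply/eqP; rewrite eq_le qp/=.
pose q' : {linear V -> R^o} :=
  HB.pack (q : V -> R^o) (GRing.isLinear.Build _ _ _ _ _ lq).
rewrite -lerN2 -[X in X <= _](linearN q' v).
exact: le_trans (qd _) (descend_opp v sp).
Qed.

End SublinearFunctionals.

(** * Bounded operators: norm estimates, composition, norming functionals *)

Section BoundedOperators.
Context {R : realType} {X Y : normedModType R}.

Lemma linear_bounded_by_continuous (f : X -> Y) (M : R) :
  linear f -> (forall x, `|f x| <= M * `|x|) -> continuous f.
Proof.
move=> lf fM.
pose f' : {linear X -> Y} := HB.pack f (GRing.isLinear.Build _ _ _ _ _ lf).
apply: (@bounded_linear_continuous _ _ _ f'); apply/linear_boundedP.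
by near=> r => x; apply: le_trans (fM x) _; rewrite ler_wpM2r.
Unshelve. all: by end_near. Qed.

Lemma linear_continuous_bounded_by (f : X -> Y) : linear f -> continuous f ->
  exists2 M : R, 0 < M & forall x, `|f x| <= M * `|x|.
Proof.
move=> lf cf.
pose f' : {linear X -> Y} := HB.pack f (GRing.isLinear.Build _ _ _ _ _ lf).
have /linear_bounded_continuous/linear_boundedP fM : continuous f' := cf.
near +oo_R => M; exists M; last by near: M.
by near: M; exact: nbhs_pinfty_gt.
Unshelve. all: by end_near. Qed.

Lemma opnorm_apply (T : 'L(X, Y)) (x : X) : `|T x| <= `|T| * `|x|.
Proof.
have [->|x0] := eqVneq x 0; first by rewrite linear0 !normr0 mulr0.
have := @opnorm_ub _ _ _ T (`|x|^-1 *: x).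
rewrite normfZV// lexx => /(_ isT).
by rewrite linearZ/= normrZ normfV normr_id ler_pdivrMl ?normr_gt0// mulrC.
Qed.

Lemma opnorm_le_bound (T : 'L(X, Y)) (M : R) : 0 <= M ->
  (forall x, `|T x| <= M * `|x|) -> `|T| <= M.
Proof.
move=> M0 TM; apply: opnorm_le => x x1.
by apply: le_trans (TM x) _; rewrite ler_piMr.
Qed.

Lemma exists_bounded_linear (f : X -> Y) (M : R) : 0 <= M -> linear f ->
  (forall x, `|f x| <= M * `|x|) ->
  exists T : 'L(X, Y), (forall x, T x = f x) /\ `|T| <= M.
Proof.
move=> M0 lf fM.
have fP : f \in @bounded_linear_pred R X Y.
  by apply/bounded_linearP; split=> //; exact: linear_bounded_by_continuous fM.
by exists (BoundedLinear fP); split=> //; exact: opnorm_le_bound.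
Qed.

Lemma sum_bounded_linearE (n : nat) (T : 'I_n -> 'L(X, Y)) (x : X) :
  (\sum_(i < n) T i) x = \sum_(i < n) T i x.
Proof.
by elim: n T => [|n IH] T; rewrite ?big_ord0// !big_ord_recr/= -IH.
Qed.

End BoundedOperators.

Lemma dualZ (R : realType) (X : normedModType R) (f : dual_space X) (a : R) (x : X) :
  f (a *: x) = a * f x.
Proof. exact: linearZ. Qed.

Lemma bounded_linear_comp_spec (R : realType) (X Y Z : normedModType R)
  (S : 'L(Y, Z)) (T : 'L(X, Y)) : S \o T \in @bounded_linear_pred R X Z.
Proof.
apply/bounded_linearP; split=> [a x y|x] /=; first by rewrite !linearP.
by apply: continuous_comp; exact: bounded_linear_cont.
Qed.

Definition comp_bounded (R : realType) (X Y Z : normedModType R)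
    (S : 'L(Y, Z)) (T : 'L(X, Y)) : 'L(X, Z) :=
  BoundedLinear (bounded_linear_comp_spec S T).

Lemma norm_comp_bounded (R : realType) (X Y Z : normedModType R)
    (S : 'L(Y, Z)) (T : 'L(X, Y)) : `|comp_bounded S T| <= `|S| * `|T|.
Proof.
apply: opnorm_le_bound => [|x]; first exact: mulr_ge0.
apply: le_trans (opnorm_apply S (T x)) _; rewrite -mulrA ler_wpM2l//.
exact: opnorm_apply.
Qed.

(** Hahn-Banach for the norm as sublinear functional; the one-sided bound at [x] and [- x] gives
    operator norm at most 1. *)
Lemma norming_functional (R : realType) (X : normedModType R) (v : X) :
  exists f : dual_space X, `|f| <= 1 /\ f v = `|v|.
Proof.
have snorm : sublinear (fun x : X => `|x|).
  split=> [x y|c x c0]; first exact: ler_normD.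
  by rewrite normrZ ger0_norm.
have [f [lf fle fv]] := Hahn_Banach v snorm.
pose f' : {linear X -> R^o} := HB.pack f (GRing.isLinear.Build _ _ _ _ _ lf).
have [|T [Tf T1]] := @exists_bounded_linear R X R^o f 1 ler01 lf.
  move=> x; rewrite mul1r ler_norml fle andbT -normrN.
  by rewrite lerNl -[X in X <= _](linearN f' x).
by exists T; rewrite Tf.
Qed.

(** * Schauder bases: expansions, basis constant, extension from the basis, multipliers *)

Section SchauderBases.
Context {R : realType} {X : completeNormedModType R}.
Context {e : nat -> X} {es : nat -> dual_space X}.
Hypotheses (basis_e : schauder_basis e) (bio : biorthogonal e es).

(** Continuity of [es m] forces the coefficients supplied by the basis property to be the values of
    the biorthogonal functionals. *)
Lemma basis_expansion (x : X) : series (fun n => es n x *: e n) @ \oo --> x.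
Proof.
have [a [ax _]] := basis_e x.
suff -> : (fun n => es n x *: e n) = (fun n => a n *: e n) by [].
apply/funext => m; congr (_ *: _).
have ecx : es m (series (fun n => a n *: e n) n) @[n --> \oo] --> es m x.
  by apply: continuous_cvg ax; exact: bounded_linear_cont.
(* The partial sum of index [n] runs over indices below [n], so from [m.+1] on its image under
   [es m] is constantly [a m]. *)
apply: (@cvg_unique _ (@norm_hausdorff _ R^o) _ _ _ _ ecx).
apply: cvg_near_cst; exists m.+1 => // n /= mn; apply/eqP.
rewrite /series/= linear_sum/= (big_nat_widenl _ 0)// big_mkord.
rewrite (bigD1 (Ordinal mn))//=.
rewrite dualZ bio eqxx mulr1 big1 ?addr0// => i im.
rewrite dualZ bio (_ : (m == i) = false) ?mulr0//.
by apply/eqP => mi; move: im; rewrite -val_eqE/= mi eqxx.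
Qed.

#[local] Arguments basis_expansion x : clear implicits.

Lemma image_expansion (Y : normedModType R) (T : 'L(X, Y)) (x : X) :
  series (fun n => es n x *: T (e n)) @ \oo --> T x.
Proof.
rewrite (_ : series _ = T \o series (fun n => es n x *: e n)).
  exact: (cvg_comp _ _ (basis_expansion x) (@bounded_linear_cont _ _ _ T x)).
apply/funext => n; rewrite /series/= linear_sum; apply: eq_bigr => i _.
by rewrite linearZ.
Qed.

#[local] Arguments image_expansion [Y] T x.

Lemma eq_on_basis (Y : normedModType R) (S T : 'L(X, Y)) :
  (forall n, S (e n) = T (e n)) -> S = T.
Proof.
move=> ST; apply/val_inj/funext => x /=.
apply: (@cvg_unique _ (@norm_hausdorff _ Y) _ _ _ _ (image_expansion S x)).
rewrite (_ : (fun n => _) = (fun n => es n x *: T (e n))).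
  exact: image_expansion.
by apply/funext => n; rewrite ST.
Qed.

Lemma coordinate_sum (n : nat) (mu : 'I_n -> R) (i : 'I_n) :
  es i (\sum_(j < n) mu j *: e j) = mu i.
Proof.
rewrite linear_sum (bigD1 i)//= dualZ bio eqxx mulr1 big1 ?addr0// => j ji.
by rewrite dualZ bio -[_ == _ :> nat]/(i == j) eq_sym (negPf ji) mulr0.
Qed.

Lemma biorthogonal_sum (n : nat) (a mu : 'I_n -> R) :
  (\sum_(i < n) a i *: es i) (\sum_(i < n) mu i *: e i) = \sum_(i < n) a i * mu i.
Proof.
rewrite sum_bounded_linearE; apply: eq_bigr => i _.
by rewrite -[LHS]/(a i * es i (\sum_(j < n) mu j *: e j)) coordinate_sum.
Qed.

Lemma diag_sumE (n : nat) (a : 'I_n -> R) (x : X) :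
  (\sum_(i < n) a i *: (es i \otimes e i)) x = \sum_(i < n) (a i * es i x) *: e i.
Proof.
by rewrite sum_bounded_linearE; apply: eq_bigr => i _; rewrite -scalerA.
Qed.

Lemma comp_diag_sum (n : nat) (a b : 'I_n -> R) :
  comp_bounded (\sum_(i < n) a i *: (es i \otimes e i))
    (\sum_(i < n) b i *: (es i \otimes e i)) =
  \sum_(i < n) (a i * b i) *: (es i \otimes e i).
Proof.
apply/val_inj/funext => x /=; rewrite !diag_sumE; apply: eq_bigr => i _.
by rewrite coordinate_sum mulrA.
Qed.

Definition partial_sum (n : nat) : 'L(X, X) := \sum_(i < n) es i \otimes e i.

Lemma partial_sumE (n : nat) (x : X) :
  partial_sum n x = \sum_(i < n) es i x *: e i.
Proof. exact: sum_bounded_linearE. Qed.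

(** Uniform boundedness: at each [x] the partial sums converge, hence are bounded. [K] bounds the
    basis constant. *)
Lemma partial_sum_bounded : exists2 K : R, 0 < K & forall n, `|partial_sum n| <= K.
Proof.
pose F := range (fun n => partial_sum n : X -> X).
have F_lin f : F f -> bounded_fun_norm f /\ linear f.
  move=> [n _ <-]; split; last exact: bounded_linear_lin.
  by apply/bounded_funP/linear_bounded_continuous; exact: bounded_linear_cont.
have F_pt : pointwise_bounded F.
  move=> x; have /cvgP/cvg_seq_bounded/pinfty_ex_gt0[M M0 xM] := basis_expansion x.
  exists M => _ [n _ <-]; rewrite partial_sumE.
  by have := xM n I; rewrite /series/= big_mkord.
have [M FM] := Banach_Steinhauss F_lin F_pt 1.
exists (`|M| + 1); first by rewrite ltr_wpDl.
move=> n; apply: opnorm_le => x x1.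
have /le_trans : `|partial_sum n x| <= M by apply: FM => //; exists n.
by apply; rewrite (le_trans (ler_norm _))// lerDl.
Qed.

(** The sum is [f] composed with the projection [partial_sum n]. *)
Lemma norm_dual_partial_sum (f : dual_space X) (n : nat) :
  `|\sum_(i < n) f (e i) *: es i| <= `|f| * `|partial_sum n|.
Proof.
rewrite (_ : \sum_(i < n) _ = comp_bounded f (partial_sum n)).
  exact: norm_comp_bounded.
apply/val_inj/funext => x /=; rewrite sum_bounded_linearE partial_sumE.
rewrite linear_sum/=; apply: eq_bigr => i _.
by rewrite dualZ; exact: mulrC.
Qed.

(** The bound on finite sums makes the series with terms [es n x *: y n] Cauchy, hence convergent as
    [Y] is complete, and it survives in the limit. *)
Lemma extend_from_basis (Y : completeNormedModType R) (y : nat -> Y) (M : R) :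
  0 <= M ->
  (forall (n : nat) (mu : 'I_n -> R),
    `|\sum_(i < n) mu i *: y i| <= M * `|\sum_(i < n) mu i *: e i|) ->
  exists T : 'L(X, Y), (forall n, T (e n) = y n) /\ `|T| <= M.
Proof.
move=> M0 yM.
have yMx m n (x : X) : `|\sum_(m <= i < n) es i x *: y i| <=
    M * `|\sum_(m <= i < n) es i x *: e i|.
  (* Zero coefficients below [m] turn a block into an initial sum, to which the hypothesis
     applies. *)
  have cut (Z : lmodType R) (z : nat -> Z) : \sum_(m <= i < n) es i x *: z i =
      \sum_(i < n) (if (m <= i)%N then es i x else 0) *: z i.
    rewrite (big_nat_widenl _ 0)// big_mkord big_mkcond/=; apply: eq_bigr => i _.
    by case: ifP; rewrite ?scale0r.
  by rewrite !cut.
pose S x := series (fun n => es n x *: y n).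
have S_cvg x : cvgn (S x).
  apply/cauchy_cvgP/cauchy_seriesP => d d0.
  have /cauchy_seriesP : cauchy (series (fun n => es n x *: e n) @ \oo).
    by apply/cauchy_cvgP/cvg_ex; exists x; exact: basis_expansion.
  (* [M] may vanish, so the tolerance is divided by [M + 1]. *)
  have M1 : 0 < M + 1 by rewrite ltr_wpDl.
  move=> /(_ (d / (M + 1))); rewrite divr_gt0// => /(_ isT).
  apply: filterS => -[m n] /= mn; apply: le_lt_trans (yMx m n x) _.
  apply: (@le_lt_trans _ _ ((M + 1) * `|\sum_(m <= i < n) es i x *: e i|)).
    by rewrite ler_wpM2r// lerDl.
  by rewrite mulrC -ltr_pdivlMr.
have lS : linear (fun x => limn (S x)).
  move=> a u v; apply/cvg_lim => //.
  rewrite (_ : S _ = (fun n => a *: S u n + S v n)); last first.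
    apply/funext => n; rewrite /S /series/= scaler_sumr -big_split/=.
    by apply: eq_bigr => i _; rewrite linearP scalerDl scalerA.
  by apply: cvgD; [apply: cvgZl_tmp; exact: S_cvg|exact: S_cvg].
have SM x : `|limn (S x)| <= M * `|x|.
  have cl : `|S x n| @[n --> \oo] --> `|limn (S x)| by apply: cvg_norm; exact: S_cvg.
  have cr : M * `|series (fun n => es n x *: e n) n| @[n --> \oo] --> M * `|x|.
    by apply: cvgMl_tmp; apply: cvg_norm; exact: basis_expansion.
  by apply: ler_cvg_to cl cr _; near=> n; exact: yMx.
have [T [TS TM]] := exists_bounded_linear M0 lS SM.
exists T; split=> // m; rewrite TS; apply/cvg_lim => //.
apply: cvg_near_cst; exists m.+1 => // n /= mn; apply/eqP.
rewrite /S /series/= big_mkord (bigD1 (Ordinal mn))//=.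
rewrite bio eqxx scale1r big1 ?addr0// => i im.
rewrite bio (_ : (_ == _) = false) ?scale0r//.
by apply/eqP => mi; move: im; rewrite -val_eqE/= mi eqxx.
Unshelve. all: by end_near. Qed.

(** With [g] norming [z], the norm of [z] is the value at the sum of the [mu i *: e i] of the
    functional with coefficients [f (e i) * g (e i)]. Submultiplicativity separates [f] from [g],
    and truncating each costs a factor [K]. *)
Lemma norm_multiplier_sum (K C : R) (f : dual_space X) : 0 <= C ->
  (forall n, `|partial_sum n| <= K) ->
  (forall (n : nat) (a b : 'I_n -> R),
    `|\sum_(i < n) (a i * b i) *: es i| <=
      C * `|\sum_(i < n) a i *: es i| * `|\sum_(i < n) b i *: es i|) ->
  forall (n : nat) (mu : 'I_n -> R),
  `|\sum_(i < n) mu i *: (f (e i) *: e i)| <=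
    C * K ^+ 2 * `|f| * `|\sum_(i < n) mu i *: e i|.
Proof.
move=> C0 PK subm n mu.
set z := \sum_(i < n) mu i *: (f (e i) *: e i).
have [g [g1 gz]] := norming_functional z.
have -> : `|z| = (\sum_(i < n) (f (e i) * g (e i)) *: es i) (\sum_(i < n) mu i *: e i).
  rewrite biorthogonal_sum -gz linear_sum/=; apply: eq_bigr => i _.
  by rewrite !dualZ mulrC.
apply: le_trans (ler_norm _) _; apply: le_trans (opnorm_apply _ _) _.
rewrite ler_wpM2r//; apply: le_trans (subm _ _ _) _.
have Pf : `|\sum_(i < n) f (e i) *: es i| <= `|f| * K.
  by apply: le_trans (norm_dual_partial_sum _ _) _; rewrite ler_wpM2l.
have Pg : `|\sum_(i < n) g (e i) *: es i| <= K.
  apply: le_trans (norm_dual_partial_sum _ _) _.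
  by rewrite -[K]mul1r ler_pM.
rewrite (_ : C * K ^+ 2 * `|f| = C * (`|f| * K) * K); last first.
  by rewrite expr2 -!mulrA; congr (_ * _); rewrite mulrC -mulrA mulrCA.
apply: ler_pM => //; first exact: mulr_ge0.
by rewrite ler_wpM2l.
Qed.

(** Domination is exactly the bound needed to extend the constant values 1 from the basis. *)
Lemma summing_functional : dominates_summing_basis e ->
  exists s : dual_space X, forall n, s (e n) = 1.
Proof.
move=> [C C0 dom].
have [||s [se _]] := @extend_from_basis R^o (fun=> 1) C^-1.
- by rewrite invr_ge0 ltW.
- move=> n mu; rewrite ler_pdivlMl//; apply: le_trans (dom n mu).
  rewrite (_ : \sum_(i < n) mu i *: _ = \sum_(i < n) mu i)//.
  by apply: eq_bigr => i _; exact: mulr1.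
- by exists s.
Qed.

(** [M] is chosen before [f], so that the map from functionals to multipliers will be bounded. *)
Lemma exists_multiplier : dual_norm_submultiplicative es ->
  exists2 M : R, 0 <= M & forall f : dual_space X, exists T : Ldiag e,
    (forall n, T (e n) = f (e n) *: e n) /\ `|T| <= M * `|f|.
Proof.
move=> [C /ltW C0 subm]; have [K K0 PK] := partial_sum_bounded.
have CK0 : 0 <= C * K ^+ 2 by apply: mulr_ge0 => //; exact/exprn_ge0/ltW.
exists (C * K ^+ 2) => // f.
have [||T [Te TM]] :=
  @extend_from_basis X (fun n => f (e n) *: e n) (C * K ^+ 2 * `|f|).
- exact: mulr_ge0.
- exact: norm_multiplier_sum.
have Td : T \in diagonal_pred e by apply/asboolP; exists (fun n => f (e n)).
by exists (LDiag Td).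
Qed.

End SchauderBases.

Theorem theorem1p1 (R : realType) (X : completeNormedModType R)
    (e : nat -> X) (es : nat -> dual_space X) :
  schauder_basis e -> biorthogonal e es ->
  (exists Phi : dual_space X -> Ldiag e,
     linear_homeomorphism Phi /\
     forall n, Ldiag_op (Phi (es n)) = es n \otimes e n)
  <->
  (dominates_summing_basis e /\ dual_norm_submultiplicative es).
Proof.
move=> basis_e bio; split.
  move=> [Phi [[lPhi cPhi [Psi [PhiK PsiK cPsi]]] Phi_es]].
  have lPsi : linear Psi.
    by move=> a S T; apply: (can_inj PhiK); rewrite lPhi !PsiK.
  have [M M0 PhiM] := linear_continuous_bounded_by lPhi cPhi.
  have [N N0 PsiN] := linear_continuous_bounded_by lPsi cPsi.
  pose D n (a : 'I_n -> R) := \sum_(i < n) a i *: (es i \otimes e i).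
  have PhiE n (a : 'I_n -> R) : Ldiag_op (Phi (\sum_(i < n) a i *: es i)) = D n a.
    have lop : linear (fun f => Ldiag_op (Phi f)) by move=> b f g; rewrite lPhi.
    pose op : {linear dual_space X -> 'L(X, X)} :=
      HB.pack (fun f => Ldiag_op (Phi f)) (GRing.isLinear.Build _ _ _ _ _ lop).
    rewrite -[LHS]/(op _) linear_sum; apply: eq_bigr => i _.
    by rewrite linearZ/= Phi_es.
  (* The norm of [Ldiag e] is by definition the operator norm, so [PhiM] applies directly. *)
  have D_le n (a : 'I_n -> R) : `|D n a| <= M * `|\sum_(i < n) a i *: es i|.
    by rewrite -PhiE; exact: PhiM.
  have le_D n (a : 'I_n -> R) : `|\sum_(i < n) a i *: es i| <= N * `|D n a|.
    by rewrite -PhiE -[X in `|X| <= _]PhiK; exact: PsiN.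
  split.
    have [K K0 PK] := partial_sum_bounded basis_e bio.
    have NK0 : 0 < N * K by exact: mulr_gt0.
    exists (N * K)^-1 => [|n mu]; first by rewrite invr_gt0.
    rewrite ler_pdivrMl//.
    (* The sum of the [mu i] is the value of the functional with all coefficients 1, whose image
       under [Phi] is [partial_sum n]; hence the constant [N * K]. *)
    have <- : (\sum_(i < n) 1 *: es i) (\sum_(i < n) mu i *: e i) = \sum_(i < n) mu i.
      by rewrite biorthogonal_sum//; apply: eq_bigr => i _; rewrite mul1r.
    apply: le_trans (opnorm_apply _ _) _; rewrite ler_wpM2r//.
    apply: le_trans (le_D _ _) _; rewrite ler_wpM2l ?(ltW N0)//.
    by rewrite /D (eq_bigr _ (fun i _ => scale1r _)); exact: PK.
  (* [N] pays for passing to operators, where the product is a composition; each [M] pays for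
     returning one factor to the dual. *)
  exists (N * M * M) => [|n a b]; first by rewrite !mulr_gt0.
  apply: le_trans (le_D _ _) _; rewrite -!mulrA ler_wpM2l ?(ltW N0)//.
  rewrite /D -comp_diag_sum//; apply: le_trans (norm_comp_bounded _ _) _.
rewrite [leRHS]mulrA [leRHS]mulrACA.
  by apply: ler_pM => //; exact: D_le.
move=> [dom subm]; have [s se] := summing_functional basis_e bio dom.
have [M M0 /choice[Phi PhiP]] := exists_multiplier basis_e bio subm.
have Phie f n : Phi f (e n) = f (e n) *: e n by exact: (PhiP f).1.
(* The choice of [Phi] is pointwise; linearity holds because an operator is determined by its values
   on the basis. *)
have lPhi : linear Phi.
  move=> a f g; apply/val_inj/(eq_on_basis basis_e bio) => n.
  rewrite Phie -[RHS]/(a *: Phi f (e n) + Phi g (e n)) !Phie scalerA.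
  by rewrite -[(a *: f + g) (e n)]/(a * f (e n) + g (e n)) scalerDl.
(* Since [s (e n) = 1], composing with [s] reads off the diagonal entries of [T]. *)
pose Psi (T : Ldiag e) : dual_space X := comp_bounded s T.
have lPsi : linear Psi.
  move=> a S T; apply/val_inj/funext => x.
  rewrite -[LHS]/(s (a *: Ldiag_op S x + Ldiag_op T x)).
  by rewrite -[RHS]/(a *: s (Ldiag_op S x) + s (Ldiag_op T x)) linearP.
exists Phi; split.
  split=> //.
    by apply: (linear_bounded_by_continuous lPhi) => f; exact: (PhiP f).2.
  exists Psi; split.
  - move=> f; apply/(eq_on_basis basis_e bio) => n.
    by rewrite /= Phie dualZ se mulr1.
  - move=> T; apply/val_inj/(eq_on_basis basis_e bio) => n.
    have [lambda Te] := asboolP _ (Ldiag_spec T).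
    by rewrite Phie /= Te dualZ se mulr1.
  - by apply: (linear_bounded_by_continuous lPsi) => T; exact: norm_comp_bounded.
move=> n; apply/(eq_on_basis basis_e bio) => m; rewrite Phie /= bio.
by case: eqP => [->//|_]; rewrite !scale0r.
Qed.
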